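(* Let $T$ be a generalized curvature tensor on a semi-Riemannian manifold $(M,g)$, $\dim M = n\geq 4$, with Riemann-Christoffel curvature tensor $R$, Ricci tensor $S$, scalar curvature $\kappa$ and Weyl conformal curvature tensor $C$. If at a point $x\in M$ $$T=\alpha_{1}\, R+\frac{\alpha_{2}}{2}\, S\wedge S+\alpha_{3}\, g\wedge S+\alpha_{4}\, g\wedge S^{2}+\frac{\alpha_{5}}{2}\, g\wedge g$$ for some $\alpha_{1},\ldots,\alpha_{5}\in\mathbb{R}$, then at $x$ $$\mathrm{Weyl}(T)=\alpha_{1}\, C+\frac{\alpha_{2}}{n-2}\, E,$$ where $$E=g\wedge S^{2}+\frac{n-2}{2}\, S\wedge S-\kappa\, g\wedge S+\frac{\kappa^{2}-\mathrm{tr}_{g}(S^{2})}{2(n-1)}\, g\wedge g.$$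
   Context: Manifolds are connected, paracompact, of class $C^\infty$; the metric $g$ is nondegenerate of arbitrary signature. Conventions: ${\mathcal R}(X,Y)Z=\nabla_X\nabla_YZ-\nabla_Y\nabla_XZ-\nabla_{[X,Y]}Z$, $R(X_1,X_2,X_3,X_4)=g({\mathcal R}(X_1,X_2)X_3,X_4)$, $S(X,Y)=\mathrm{tr}\{Z\mapsto{\mathcal R}(Z,X)Y\}$, $g({\mathcal S}X,Y)=S(X,Y)$, $\kappa=\mathrm{tr}\,{\mathcal S}$, $S^{2}(X,Y)=S({\mathcal S}X,Y)$. The Kulkarni-Nomizu product of symmetric $(0,2)$-tensors $A,B$ is $$(A\wedge B)(X_1,X_2,X_3,X_4)=A(X_1,X_4)B(X_2,X_3)+A(X_2,X_3)B(X_1,X_4)-A(X_1,X_3)B(X_2,X_4)-A(X_2,X_4)B(X_1,X_3),$$ and $C=R-\frac{1}{n-2}\, g\wedge S+\frac{\kappa}{2(n-2)(n-1)}\, g\wedge g$. A generalized curvature tensor is a $(0,4)$-tensor $T(X_1,X_2,X_3,X_4)=g({\mathcal T}(X_1,X_2)X_3,X_4)$, with each ${\mathcal T}(X,Y)$ a skew-symmetric endomorphism, such that $T(X_1,X_2,X_3,X_4)=T(X_3,X_4,X_1,X_2)$ and $T(X_1,X_2,X_3,X_4)+T(X_2,X_3,X_1,X_4)+T(X_3,X_1,X_2,X_4)=0$. Its Ricci tensor is $\mathrm{Ric}(T)(X,Y)=\mathrm{tr}\{Z\mapsto{\mathcal T}(Z,X)Y\}$, its scalar curvature is $\kappa(T)=\mathrm{tr}_g(\mathrm{Ric}(T))$,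 and its Weyl tensor is $$\mathrm{Weyl}(T)=T-\frac{1}{n-2}\, g\wedge\mathrm{Ric}(T)+\frac{\kappa(T)}{2(n-2)(n-1)}\, g\wedge g.$$ *)

(* Defs.v *)
From HB Require Import structures.
From mathcomp Require Import all_boot all_order all_algebra.
From mathcomp Require Import all_classical all_reals all_analysis.
Set Implicit Arguments.
Unset Strict Implicit.
Unset Printing Implicit Defensive.
Import Order.TTheory GRing.Theory Num.Theory.
Import numFieldNormedType.Exports.
Local Open Scope classical_set_scope.
Local Open Scope ring_scope.

Section SmoothFunctions.
Variables (R : realType) (n : nat).
Implicit Types (U : set 'rV[R]_n) (f : 'rV[R]_n -> R).

Definition partial (i : 'I_n) f : 'rV[R]_n -> R :=
  fun y => 'D_(delta_mx 0 i) f y.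

Fixpoint Ck_on (k : nat) U f : Prop :=
  {in U, continuous f} /\
  if k is k'.+1 then
    forall i : 'I_n,
      (forall y, U y -> derivable f y (delta_mx 0 i)) /\
      Ck_on k' U (partial i f)
  else True.

Definition smooth_on U f : Prop := forall k, Ck_on k U f.

End SmoothFunctions.

Definition paracompact (M : topologicalType) : Prop :=
  forall U : set (set M),
    (forall A, U A -> open A) -> \bigcup_(A in U) A = [set: M] ->
  exists V : set (set M),
    [/\ forall B, V B -> open B,
        \bigcup_(B in V) B = [set: M],
        forall B, V B -> exists2 A, U A & B `<=` A &
        forall x : M, exists2 N, nbhs x N &
          finite_set [set B | V B /\ B `&` N !=set0]].

Section Charts.
Variables (R : realType) (n : nat) (M : topologicalType).

(* [coord] and its inverse [chart_inv] are total functions, but they are only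
   meaningful on [dom] and on [coord @` dom] respectively. *)
Record chart := Chart {
  dom : set M;
  coord : M -> 'rV[R]_n;
  chart_inv : 'rV[R]_n -> M }.

Definition chart_image (c : chart) : set 'rV[R]_n := coord c @` dom c.

Definition is_chart (c : chart) : Prop :=
  [/\ open (dom c), open (chart_image c),
      forall x, dom c x -> chart_inv c (coord c x) = x,
      {in dom c, continuous (coord c)} &
      {in chart_image c, continuous (chart_inv c)}].

Definition transition (c c' : chart) : 'rV[R]_n -> 'rV[R]_n :=
  coord c' \o chart_inv c.

Definition smoothly_compatible (c c' : chart) : Prop :=
  forall i : 'I_n,
    smooth_on (coord c @` (dom c `&` dom c'))
      (fun y => transition c c' y 0 i).

(* Tangent vectors at x are represented by their components in a chart;
   this is the change of components from [c] to [c']. *)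
Definition tangent_transition (c c' : chart) (x : M) (v : 'rV[R]_n) :
    'rV[R]_n :=
  'D_v (transition c c') (coord c x).

End Charts.

Record smoothManifold (R : realType) (n : nat) := SmoothManifold {
  carrier :> topologicalType;
  atlas : set (chart R n carrier);
  _ : hausdorff_space carrier;
  _ : paracompact carrier;
  _ : connected [set: carrier];
  _ : forall c, atlas c -> is_chart c;
  _ : forall x : carrier, exists2 c, atlas c & dom c x;
  _ : forall c c', atlas c -> atlas c' -> smoothly_compatible c c' }.

Section PointwiseAlgebra.
Variables (R : realType) (n : nat).
Local Notation V := 'rV[R]_n.
Variable G : 'M[R]_n.
Implicit Types (A B : V -> V -> R) (T : V -> V -> V -> V -> R).

Definition inner (X Y : V) : R := (X *m G *m Y^T) 0 0.

(* The vector representing the linear form [w]: inner (sharp w) Y = w Y. *)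
Definition sharp (w : V -> R) : V :=
  (\row_(j < n) w (delta_mx 0 j)) *m invmx G.

Definition endo_trace (f : V -> V) : R := \tr (lin1_mx f).

(* The operator attached to A: inner (endo_of A X) Y = A X Y. *)
Definition endo_of A (X : V) : V := sharp (A X).

Definition metric_trace A : R := endo_trace (endo_of A).

(* S^2(X, Y) = S(SX, Y). *)
Definition form_square A (X Y : V) : R := A (endo_of A X) Y.

Definition kulkarni_nomizu A B (X1 X2 X3 X4 : V) : R :=
  A X1 X4 * B X2 X3 + A X2 X3 * B X1 X4
  - A X1 X3 * B X2 X4 - A X2 X4 * B X1 X3.

Definition curvature_operator T (X Y Z : V) : V := sharp (T X Y Z).

Definition ricci_of_operator (F : V -> V -> V -> V) (X Y : V) : R :=
  endo_trace (fun Z => F Z X Y).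

Definition conformal_part T A (k : R) (X1 X2 X3 X4 : V) : R :=
  T X1 X2 X3 X4
  - 1 / (n%:R - 2) * kulkarni_nomizu inner A X1 X2 X3 X4
  + k / (2 * (n%:R - 2) * (n%:R - 1)) *
      kulkarni_nomizu inner inner X1 X2 X3 X4.

Definition Ric T : V -> V -> R := ricci_of_operator (curvature_operator T).

Definition scal T : R := metric_trace (Ric T).

Definition Weyl T : V -> V -> V -> V -> R :=
  conformal_part T (Ric T) (scal T).

Definition multilinear4 T : Prop :=
  [/\ forall Y Z W, scalar (fun X => T X Y Z W),
      forall X Z W, scalar (fun Y => T X Y Z W),
      forall X Y W, scalar (fun Z => T X Y Z W) &
      forall X Y Z, scalar (fun W => T X Y Z W)].

Definition curvature_symmetries T : Prop :=
  [/\ forall X1 X2 X3 X4,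
        inner (curvature_operator T X1 X2 X3) X4 =
        - inner X3 (curvature_operator T X1 X2 X4),
      forall X1 X2 X3 X4, T X1 X2 X3 X4 = T X3 X4 X1 X2 &
      forall X1 X2 X3 X4,
        T X1 X2 X3 X4 + T X2 X3 X1 X4 + T X3 X1 X2 X4 = 0].

End PointwiseAlgebra.

Section LocalGeometry.
Variables (R : realType) (n : nat).
Local Notation V := 'rV[R]_n.
Variable G : V -> 'M[R]_n.
Implicit Types X Y Z : V -> V.

(* Gamma^k_ij: the upper index comes last. *)
Definition christoffel (i j k : 'I_n) (y : V) : R :=
  2^-1 * \sum_(l < n) invmx (G y) k l *
    (partial i (fun z => G z j l) y + partial j (fun z => G z i l) y
     - partial l (fun z => G z i j) y).

Definition nabla X Y : V -> V := fun y =>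
  \row_(k < n)
    (\sum_(i < n) X y 0 i * partial i (fun z => Y z 0 k) y +
     \sum_(i < n) \sum_(j < n)
        christoffel i j k y * X y 0 i * Y y 0 j).

Definition lie_bracket X Y : V -> V := fun y =>
  \row_(k < n)
    \sum_(i < n) (X y 0 i * partial i (fun z => Y z 0 k) y
                  - Y y 0 i * partial i (fun z => X z 0 k) y).

Definition curvature_field X Y Z : V -> V := fun y =>
  nabla X (nabla Y Z) y - nabla Y (nabla X Z) y - nabla (lie_bracket X Y) Z y.

Definition coord_frame (i : 'I_n) : V -> V := fun=> delta_mx 0 i.

(* [curvature_field] is tensorial, hence determined at y by its values on the
   coordinate frame; this is its multilinear extension to tangent vectors. *)
Definition riemann_operator (y : V) (u v w : V) : V :=
  \sum_(i < n) \sum_(j < n) \sum_(k < n)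
    (u 0 i * v 0 j * w 0 k) *:
      curvature_field (coord_frame i) (coord_frame j) (coord_frame k) y.

End LocalGeometry.

(* The metric is given by its Gram matrix in each chart. *)
Record semiRiemannianMetric (R : realType) (n : nat)
    (M : smoothManifold R n) := SemiRiemannianMetric {
  gram :> chart R n M -> M -> 'M[R]_n;
  _ : forall c x, atlas c -> dom c x -> (gram c x)^T = gram c x;
  _ : forall c x, atlas c -> dom c x -> gram c x \in unitmx;
  _ : forall c, atlas c -> forall i j,
        smooth_on (chart_image c) (fun y => gram c (chart_inv c y) i j);
  _ : forall c c' x, atlas c -> atlas c' -> dom c x -> dom c' x ->
        forall X Y : 'rV[R]_n,
          inner (gram c x) X Y =
          inner (gram c' x) (tangent_transition c c' x X)
                            (tangent_transition c c' x Y) }.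

Section SemiRiemannian.
Variables (R : realType) (n : nat) (M : smoothManifold R n).
Variable g : semiRiemannianMetric M.
Local Notation V := 'rV[R]_n.

(* Components in each chart c, at each point x of the domain of c. *)
Definition components04 : Type := chart R n M -> M -> V -> V -> V -> V -> R.

Definition tensor04 (T : components04) : Prop :=
  (forall c x, atlas c -> dom c x -> multilinear4 (T c x)) /\
  (forall c c' x, atlas c -> atlas c' -> dom c x -> dom c' x ->
     forall X1 X2 X3 X4 : V,
       T c x X1 X2 X3 X4 =
       T c' x (tangent_transition c c' x X1) (tangent_transition c c' x X2)
              (tangent_transition c c' x X3) (tangent_transition c c' x X4)).

Definition generalized_curvature_tensor (T : components04) : Prop :=
  tensor04 T /\
  forall c x, atlas c -> dom c x -> curvature_symmetries (g c x) (T c x).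

Definition metric (c : chart R n M) (x : M) : V -> V -> R := inner (g c x).

Definition riemann_endo (c : chart R n M) (x : M) : V -> V -> V -> V :=
  riemann_operator (fun y => g c (chart_inv c y)) (coord c x).

Definition riemann : components04 :=
  fun c x X1 X2 X3 X4 => metric c x (riemann_endo c x X1 X2 X3) X4.

Definition ricci (c : chart R n M) (x : M) : V -> V -> R :=
  ricci_of_operator (riemann_endo c x).

Definition ricci_square (c : chart R n M) (x : M) : V -> V -> R :=
  form_square (g c x) (ricci c x).

Definition scalar_curvature (c : chart R n M) (x : M) : R :=
  metric_trace (g c x) (ricci c x).

Definition weyl_conformal : components04 := fun c x =>
  conformal_part (g c x) (riemann c x) (ricci c x) (scalar_curvature c x).

Definition tensor_E : components04 := fun c x X1 X2 X3 X4 =>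
  kulkarni_nomizu (metric c x) (ricci_square c x) X1 X2 X3 X4
  + (n%:R - 2) / 2 * kulkarni_nomizu (ricci c x) (ricci c x) X1 X2 X3 X4
  - scalar_curvature c x *
      kulkarni_nomizu (metric c x) (ricci c x) X1 X2 X3 X4
  + (scalar_curvature c x ^+ 2 - metric_trace (g c x) (ricci_square c x)) /
      (2 * (n%:R - 1)) *
      kulkarni_nomizu (metric c x) (metric c x) X1 X2 X3 X4.

Definition weyl_of (T : components04) : components04 :=
  fun c x => Weyl (g c x) (T c x).

End SemiRiemannian.

(* Main.v *)
(* Contracting a Kulkarni-Nomizu product gives
   Ric(A /\ B) = tr(A) B + tr(B) A - A(B^# -, -) - B(A^# -, -),
   so Ric(T) and its trace are explicit combinations of g, S and S^2, and the
   claim becomes an identity between coefficients of g /\ g, g /\ S, g /\ S^2,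
   S /\ S and R. *)
Require Import Defs.
From HB Require Import structures.
From mathcomp Require Import all_boot all_order all_algebra.
From mathcomp Require Import all_classical all_reals all_analysis.
From mathcomp Require Import ring.
Set Implicit Arguments.
Unset Strict Implicit.
Unset Printing Implicit Defensive.
Import Order.TTheory GRing.Theory Num.Theory.
Local Open Scope classical_set_scope.
Local Open Scope ring_scope.

Section Contractions.
Variables (R : realType) (n : nat) (G : 'M[R]_n).
Local Notation V := 'rV[R]_n.
Implicit Types (A B : V -> V -> R) (T : V -> V -> V -> V -> R).

Definition bilinear_form A : Prop :=
  (forall Y, scalar (A ^~ Y)) /\ (forall X, scalar (A X)).

Lemma scalar_sum (l : V -> R) : scalar l ->
  forall u : V, l u = \sum_(i < n) u 0 i * l (delta_mx 0 i).
Proof.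
move=> lin_l u.
have l0 : l 0 = 0.
  (* [scalar l] is the single identity [l (a *: u + v) = a * l u + l v]; at [a = -1], [u = v = 0]
     its right side cancels. *)
  by have := lin_l (-1) 0 0; rewrite scaler0 addr0 mulN1r addNr.
have lD a v : l (a *: v) = a * l v.
  by have := lin_l a v 0; rewrite !addr0 l0 addr0.
rewrite {1}[u]row_sum_delta (big_morph l (id1 := 0) (op1 := +%R)) //.
  by apply: eq_bigr => i _; rewrite lD.
by move=> v w; have := lin_l 1 v w; rewrite scale1r mul1r.
Qed.

Lemma endo_traceE (f : V -> V) :
  endo_trace f = \sum_(i < n) f (delta_mx 0 i) 0 i.
Proof. by apply: eq_bigr => i _; rewrite mxE. Qed.

Lemma endo_traceD (f h : V -> V) :
  endo_trace (fun Z => f Z + h Z) = endo_trace f + endo_trace h.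
Proof.
by rewrite !endo_traceE -big_split; apply: eq_bigr => i _; rewrite mxE.
Qed.

Lemma endo_traceZ a (f : V -> V) :
  endo_trace (fun Z => a *: f Z) = a * endo_trace f.
Proof.
by rewrite !endo_traceE mulr_sumr; apply: eq_bigr => i _; rewrite mxE.
Qed.

(** Rank-one endomorphisms are what the two negative terms of a Kulkarni-Nomizu product become under
    contraction; this yields the mixed terms such as [A (endo_of G B X) Y]. *)
Lemma endo_trace_rank1 (l : V -> R) (u : V) : scalar l ->
  endo_trace (fun Z => l Z *: u) = l u.
Proof.
move=> lin_l; rewrite endo_traceE (scalar_sum lin_l).
by apply: eq_bigr => i _; rewrite mxE mulrC.
Qed.

Lemma endo_trace_id : endo_trace (@id V) = n%:R.
Proof.
rewrite endo_traceE (eq_bigr (fun=> 1)) => [|i _]; last by rewrite mxE !eqxx.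
by rewrite sumr_const card_ord.
Qed.

Lemma sharpD (v w : V -> R) :
  sharp G (fun W => v W + w W) = sharp G v + sharp G w.
Proof. by rewrite -mulmxDl; congr (_ *m _); apply/rowP=> j; rewrite !mxE. Qed.

Lemma sharpZ a (w : V -> R) : sharp G (fun W => a * w W) = a *: sharp G w.
Proof. by rewrite scalemxAl; congr (_ *m _); apply/rowP=> j; rewrite !mxE. Qed.

Lemma inner_bilinear : bilinear_form (inner G).
Proof.
split=> [Y a u v | X a u v]; rewrite /inner.
  by rewrite !mulmxDl -!scalemxAl !mxE.
by rewrite linearP mulmxDr -scalemxAr !mxE.
Qed.

(** [sharp] reads [w] only on the standard basis; linearity recovers [w Y] from those values once
    [invmx G] cancels against [G]. *)
Lemma inner_sharp (unitG : G \in unitmx) (w : V -> R) (Y : V) :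
  scalar w -> inner G (sharp G w) Y = w Y.
Proof.
move=> lin_w; rewrite /inner /sharp mulmxKV // (scalar_sum lin_w) mxE.
by apply: eq_bigr => i _; rewrite !mxE mulrC.
Qed.

Lemma sharp_inner (unitG : G \in unitmx) (X : V) : sharp G (inner G X) = X.
Proof.
rewrite -[RHS](mulmxK unitG) /sharp; congr (_ *m _); apply/rowP=> j.
by rewrite mxE /inner trmx_delta -colE mxE.
Qed.

Lemma metric_trace_inner (unitG : G \in unitmx) :
  metric_trace G (inner G) = n%:R.
Proof.
rewrite -endo_trace_id; congr endo_trace.
by apply/funext => X; rewrite /endo_of sharp_inner.
Qed.

Lemma metric_traceD A B :
  metric_trace G (fun X Y => A X Y + B X Y) =
    metric_trace G A + metric_trace G B.
Proof.
rewrite -endo_traceD; congr endo_trace; apply/funext => X; exact: sharpD.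
Qed.

Lemma metric_traceZ a A :
  metric_trace G (fun X Y => a * A X Y) = a * metric_trace G A.
Proof.
rewrite -endo_traceZ; congr endo_trace; apply/funext => X; exact: sharpZ.
Qed.

Lemma form_square_bilinear A : bilinear_form A ->
  bilinear_form (form_square G A).
Proof.
move=> [linAl linAr]; split=> [Y a u v | X]; last exact: linAr.
rewrite /form_square -(linAl Y); congr (A _ Y).
rewrite /endo_of -sharpZ -sharpD; congr (sharp G).
by apply/funext => W; exact: linAl.
Qed.

Lemma RicD T T' X Y :
  Ric G (fun X1 X2 X3 X4 => T X1 X2 X3 X4 + T' X1 X2 X3 X4) X Y =
    Ric G T X Y + Ric G T' X Y.
Proof.
rewrite -endo_traceD; congr endo_trace; apply/funext => Z; exact: sharpD.
Qed.

Lemma RicZ a T X Y :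
  Ric G (fun X1 X2 X3 X4 => a * T X1 X2 X3 X4) X Y = a * Ric G T X Y.
Proof.
rewrite -endo_traceZ; congr endo_trace; apply/funext => Z; exact: sharpZ.
Qed.

Lemma Ric_kulkarni_nomizu A B X Y :
    (forall Y, scalar (A ^~ Y)) -> (forall Y, scalar (B ^~ Y)) ->
  Ric G (kulkarni_nomizu A B) X Y =
    metric_trace G A * B X Y + metric_trace G B * A X Y
    - A (endo_of G B X) Y - B (endo_of G A X) Y.
Proof.
move=> linA linB.
(* Raising the last slot of the product at [(Z, X, Y, W)] gives four endomorphisms in [Z]: multiples
   of those attached to [A] and [B], and two of rank one. Signs are written [-1 *:] so that
   additivity and homogeneity of the trace suffice. *)
pose op Z := B X Y *: endo_of G A Z + A X Y *: endo_of G B Z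
  + -1 *: (A Z Y *: endo_of G B X) + -1 *: (B Z Y *: endo_of G A X).
have -> : Ric G (kulkarni_nomizu A B) X Y = endo_trace op.
  congr endo_trace; apply/funext => Z; rewrite /op /endo_of -!sharpZ -!sharpD.
  by congr (sharp G); apply/funext => W; rewrite /kulkarni_nomizu; ring.
rewrite /op !endo_traceD !endo_traceZ (endo_trace_rank1 _ (linA Y)).
by rewrite (endo_trace_rank1 _ (linB Y)) /metric_trace; ring.
Qed.

(** The operator of the metric is the identity, of trace [n], so both mixed terms equal [A X Y];
    this turns the factor [n] into [n - 2]. *)
Lemma Ric_inner_kulkarni_nomizu (unitG : G \in unitmx) A X Y :
  bilinear_form A ->
  Ric G (kulkarni_nomizu (inner G) A) X Y =
    (n%:R - 2) * A X Y + metric_trace G A * inner G X Y.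
Proof.
move=> [linAl linAr]; have [linGl _] := inner_bilinear.
rewrite Ric_kulkarni_nomizu // metric_trace_inner // /endo_of sharp_inner //.
by rewrite inner_sharp //; ring.
Qed.

Lemma Ric_kulkarni_nomizu_self A X Y : (forall Y, scalar (A ^~ Y)) ->
  Ric G (kulkarni_nomizu A A) X Y =
    2 * (metric_trace G A * A X Y - form_square G A X Y).
Proof. by move=> linA; rewrite Ric_kulkarni_nomizu // /form_square; ring. Qed.

(** Bridges the two Ricci contractions: [Ric] raises the last index of a (0,4)-tensor, which undoes
    the lowering used to define [riemann] from its operator. *)
Lemma Ric_of_operator (unitG : G \in unitmx) (F : V -> V -> V -> V) :
  Ric G (fun X1 X2 X3 X4 => inner G (F X1 X2 X3) X4) = ricci_of_operator F.
Proof.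
apply/funext => X; apply/funext => Y; congr endo_trace; apply/funext => Z.
exact: sharp_inner.
Qed.

Lemma eq_Weyl T T' :
  (forall X1 X2 X3 X4, T X1 X2 X3 X4 = T' X1 X2 X3 X4) -> Weyl G T = Weyl G T'.
Proof. by move=> eqT; congr Weyl; do 4! apply/funext => ?; exact: eqT. Qed.

End Contractions.

(** In the frame expansion of [riemann_operator] each coefficient [u 0 i * v 0 j * w 0 k] is linear
    in every slot, and the trace preserves this. *)
Lemma riemann_operator_ricci_bilinear (R : realType) (n : nat)
    (G : 'rV[R]_n -> 'M[R]_n) (y : 'rV[R]_n) :
  bilinear_form (ricci_of_operator (riemann_operator G y)).
Proof.
split=> [Y a u v | X a u v]; rewrite /ricci_of_operator;
  rewrite -endo_traceZ -endo_traceD; congr endo_trace; apply/funext => Z;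
  rewrite /riemann_operator scaler_sumr -big_split; apply: eq_bigr => i _;
  rewrite scaler_sumr -big_split; apply: eq_bigr => j _;
  rewrite scaler_sumr -big_split; apply: eq_bigr => k _ /=;
  by rewrite !mxE scalerA -scalerDl; congr (_ *: _); ring.
Qed.

(** The algebraic core at one point: the curvature enters only through an operator [F] whose Ricci
    contraction is bilinear. *)
Lemma Weyl_combination (R : realType) (n : nat) (hn : (2 < n)%N)
    (G : 'M[R]_n) (unitG : G \in unitmx)
    (F : 'rV[R]_n -> 'rV[R]_n -> 'rV[R]_n -> 'rV[R]_n)
    (a1 a2 a3 a4 a5 : R) :
  let S := ricci_of_operator F in
  let S2 := form_square G S in
  let kappa := metric_trace G S in
  let Rm X1 X2 X3 X4 := inner G (F X1 X2 X3) X4 in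
  bilinear_form S ->
  forall X1 X2 X3 X4 : 'rV[R]_n,
  Weyl G (fun X1 X2 X3 X4 =>
      a1 * Rm X1 X2 X3 X4
      + a2 / 2 * kulkarni_nomizu S S X1 X2 X3 X4
      + a3 * kulkarni_nomizu (inner G) S X1 X2 X3 X4
      + a4 * kulkarni_nomizu (inner G) S2 X1 X2 X3 X4
      + a5 / 2 * kulkarni_nomizu (inner G) (inner G) X1 X2 X3 X4) X1 X2 X3 X4 =
    a1 * conformal_part G Rm S kappa X1 X2 X3 X4
    + a2 / (n%:R - 2) *
      (kulkarni_nomizu (inner G) S2 X1 X2 X3 X4
       + (n%:R - 2) / 2 * kulkarni_nomizu S S X1 X2 X3 X4
       - kappa * kulkarni_nomizu (inner G) S X1 X2 X3 X4
       + (kappa ^+ 2 - metric_trace G S2) / (2 * (n%:R - 1)) *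
           kulkarni_nomizu (inner G) (inner G) X1 X2 X3 X4).
Proof.
move=> S S2 kappa Rm linS X1 X2 X3 X4.
have linS2 : bilinear_form S2 by exact: form_square_bilinear.
have linG := inner_bilinear G.
set T := fun _ _ _ _ => _ + _.
(* Coefficients of [S], [S2] and the metric in Ric(T). The [a2] term contributes
   [a2 * (kappa * S - S2)]; the [a5] term has factor [((n - 2) + n) / 2 = n - 1]. *)
pose cS := a1 + a2 * kappa + a3 * (n%:R - 2).
pose cS2 := a4 * (n%:R - 2) - a2.
pose cG := a3 * kappa + a4 * metric_trace G S2 + a5 * (n%:R - 1).
have RicT : Ric G T = fun X Y => cS * S X Y + cS2 * S2 X Y + cG * inner G X Y.
  apply/funext => X; apply/funext => Y; rewrite /T !RicD !RicZ.
  rewrite Ric_of_operator // Ric_kulkarni_nomizu_self; last by case: linS.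
  rewrite !Ric_inner_kulkarni_nomizu // metric_trace_inner //.
  by rewrite /cS /cS2 /cG -/kappa -/S -/S2; field.
have scalT : scal G T = cS * kappa + cS2 * metric_trace G S2 + cG * n%:R.
  by rewrite /scal RicT !metric_traceD !metric_traceZ metric_trace_inner.
have KNRicT : kulkarni_nomizu (inner G) (Ric G T) X1 X2 X3 X4 =
    cS * kulkarni_nomizu (inner G) S X1 X2 X3 X4
    + cS2 * kulkarni_nomizu (inner G) S2 X1 X2 X3 X4
    + cG * kulkarni_nomizu (inner G) (inner G) X1 X2 X3 X4.
  by rewrite RicT /kulkarni_nomizu; ring.
have n2 : n%:R - 2 != 0 :> R.
  by rewrite subr_eq0 eqr_nat gtn_eqF.
have n1 : n%:R - 1 != 0 :> R.
  by rewrite subr_eq0 pnatr_eq1 gtn_eqF // ltnW.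
(* Comparing coefficients of the products: everything in [a3], [a4], [a5] cancels, since these terms
   have the form g /\ B and so have zero Weyl part. *)
rewrite /Weyl /conformal_part KNRicT scalT /T /cS /cS2 /cG.
by field; rewrite n1 n2.
Qed.

Theorem proposition2p2 (R : realType) (n : nat) (hn : (4 <= n)%N)
  (M : smoothManifold R n) (g : semiRiemannianMetric M)
  (T : components04 M) (hT : generalized_curvature_tensor g T)
  (x : M) (c : chart R n M) (hc : atlas c) (hx : dom c x)
  (a1 a2 a3 a4 a5 : R)
  (hyp : forall X1 X2 X3 X4 : 'rV[R]_n,
     T c x X1 X2 X3 X4 =
       a1 * riemann g c x X1 X2 X3 X4
       + a2 / 2 * kulkarni_nomizu (ricci g c x) (ricci g c x) X1 X2 X3 X4
       + a3 * kulkarni_nomizu (metric g c x) (ricci g c x) X1 X2 X3 X4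
       + a4 * kulkarni_nomizu (metric g c x) (ricci_square g c x) X1 X2 X3 X4
       + a5 / 2 * kulkarni_nomizu (metric g c x) (metric g c x) X1 X2 X3 X4) :
  forall X1 X2 X3 X4 : 'rV[R]_n,
    weyl_of g T c x X1 X2 X3 X4 =
      a1 * weyl_conformal g c x X1 X2 X3 X4
      + a2 / (n%:R - 2) * tensor_E g c x X1 X2 X3 X4.
Proof.
move=> X1 X2 X3 X4.
(* Nondegeneracy is an unnamed field of the metric record, reached by destructing [g]. *)
have unitG : g c x \in unitmx by case: (g) => ? ? unit_gram ? ?; apply: unit_gram.
rewrite /weyl_of (eq_Weyl _ hyp).
(* Both sides unfold to the algebraic statement with [F := riemann_endo g c x]. *)
apply: Weyl_combination => //; first exact: ltnW.
exact: riemann_operator_ricci_bilinear.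
Qed.
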